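(* For $u,v,w\in S_n$, the following are equivalent: (1) $w\leq_u v$ in the tilted Bruhat order $D_u$; (2) $w\in[u,v]$; (3) for every sequence $\mathbf a=(a_1,\dots,a_{n-1})\in[n]^{n-1}$ such that $\{u_1,\dots,u_k\}\leq_{a_k}\{v_1,\dots,v_k\}$ for all $k\in[n-1]$, we have $\{u_1,\dots,u_k\}\leq_{a_k}\{w_1,\dots,w_k\}\leq_{a_k}\{v_1,\dots,v_k\}$ for all $k\in[n-1]$; (4) there exists a sequence $\mathbf a=(a_1,\dots,a_{n-1})\in[n]^{n-1}$ such that $\{u_1,\dots,u_k\}\leq_{a_k}\{w_1,\dots,w_k\}\leq_{a_k}\{v_1,\dots,v_k\}$ for all $k\in[n-1]$.
   Context: Permutations $w\in S_n$ are written in one-line notation $w_1\cdots w_n$, $w_i=w(i)$; $\ell(w)$ is the number of inversions; $t_{ij}=(i\ j)$. The quantum Bruhat graph $\Gamma_n$ is the directed graph on $S_n$ with edges, for $1\le i<j\le n$, $w\to wt_{ij}$ whenever $\ell(wt_{ij})=\ell(w)+1$ or $\ell(wt_{ij})=\ell(w)+1-2(j-i)$. For $u,v\in S_n$, $\ell(u,v)$ is the length (number of edges) of a shortest directed path from $u$ to $v$ in $\Gamma_n$. The tilted Bruhat order $D_u$ is the partial order on $S_n$ with $w\leq_u v$ iff $\ell(u,w)+\ell(w,v)=\ell(u,v)$. The tilted Bruhat interval is $[u,v]:=\{x\in S_n: u\leq_u x\leq_u v\}$. For $r\in[n]=\{1,\dots,n\}$, $\leq_r$ denotes the shifted linear order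 on $[n]$: $r<_r r+1<_r\cdots<_r n<_r 1<_r\cdots<_r r-1$. For subsets $A=\{a_1<_r\cdots<_r a_k\}$ and $B=\{b_1<_r\cdots<_r b_k\}$ of $[n]$ of equal size, the shifted Gale order is $A\leq_r B$ iff $a_i\leq_r b_i$ for all $i\in[k]$. *)

(* Defs.v *)
From mathcomp Require Import all_boot all_fingroup.
From mathcomp Require Import zify.

Set Implicit Arguments.
Unset Strict Implicit.
Unset Printing Implicit Defensive.

Local Open Scope nat_scope.

(* [n] is represented by 'I_n, i.e. {0, ..., n-1}: all values and positions    *)
(* are shifted down by one. Since (s * t) x = t (s x) in MathComp, the product *)
(* w t_ij (acting on positions) is written tperm i j * w here.                 *)

Definition perm_length (n : nat) (w : 'S_n) : nat :=
  #|[set p : 'I_n * 'I_n | (p.1 < p.2) && (w p.2 < w p.1)]|.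

(* The second length condition is l(w t_ij) = l(w) + 1 - 2(j - i), rearranged *)
(* because subtraction on nat is truncated.                                   *)
Definition quantum_bruhat (n : nat) : rel 'S_n := fun w w' =>
  [exists i : 'I_n, exists j : 'I_n,
    [&& i < j, w' == (tperm i j * w)%g &
        (perm_length w' == perm_length w + 1)
     || (perm_length w' + 2 * (j - i) == perm_length w + 1)]].

(* The quantum Bruhat graph is strongly connected (adjacent transpositions *)
(* give edges in both directions), so distances in it are well defined.    *)

Lemma tperm_adj_lt (n : nat) (i j x y : 'I_n) :
  j = i.+1 :> nat -> x < y -> (x, y) != (i, j) -> tperm i j x < tperm i j y.
Proof.
move=> ji xy; rewrite xpair_eqE -!val_eqE /= ji => nxy.
by rewrite !permE /= -!val_eqE /= ji; do !case: eqP => ? //=; lia.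
Qed.

Lemma perm_length_adj (n : nat) (i j : 'I_n) (w : 'S_n) :
  j = i.+1 :> nat -> w i < w j ->
  perm_length (tperm i j * w)%g = (perm_length w).+1.
Proof.
move=> ji wij; rewrite /perm_length; set I := [set _ | _]; set J := [set _ | _].
have ij : i < j by rewrite ji.
pose f (p : 'I_n * 'I_n) := (tperm i j p.1, tperm i j p.2).
have fK : involutive f by case=> x y; rewrite /f /= !tpermK.
have Iij : (i, j) \in I by rewrite inE /= !permM tpermL tpermR ij.
have Jij : (i, j) \notin J by rewrite inE /= ij /= -leqNgt ltnW.
rewrite (cardsD1 (i, j)) Iij add1n; congr _.+1.
rewrite -(card_imset _ (can_inj fK)); apply: eq_card => p.
apply/imsetP/idP => [[[x y]] | ].
  rewrite !inE /= !permM => /andP[nxy /andP[xy wxy]] ->.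
  by rewrite /f /= wxy tperm_adj_lt.
move=> Jp; exists (f p); last by rewrite fK.
have pij : p != (i, j) by apply: contraNneq Jij => <-.
case: p Jp pij => x y; rewrite !inE /= => /andP[xy wxy] nxy.
rewrite /f !permM /= !tpermK wxy tperm_adj_lt // !andbT.
apply/negP => /eqP[xi yj].
have := tpermK i j x; have := tpermK i j y.
by rewrite xi yj tpermL tpermR => yi xj; move: xy; rewrite -xj -yi ji ltnNge leqnSn.
Qed.

Lemma quantum_bruhat_adj (n : nat) (i j : 'I_n) (w : 'S_n) :
  j = i.+1 :> nat -> quantum_bruhat w (tperm i j * w)%g.
Proof.
move=> ji; apply/existsP; exists i; apply/existsP; exists j.
rewrite eqxx ji ltnSn /=.
have [wij|wji|/val_inj/perm_inj ij] := ltngtP (w i) (w j);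
  last by move: ji; rewrite ij => /n_Sn.
  by rewrite (perm_length_adj ji) // addn1 eqxx.
have := @perm_length_adj n i j (tperm i j * w)%g ji.
rewrite !permM tpermL tpermR mulgA tperm2 mul1g => /(_ wji) ->.
by apply/orP; right; lia.
Qed.

Lemma connect_tperm (n : nat) (i j : 'I_n) (w : 'S_n) :
  connect (@quantum_bruhat n) w (tperm i j * w)%g.
Proof.
wlog ij : i j / i <= j.
  by move=> th; case: (leqP i j) => [|/ltnW] /th //; rewrite tpermC.
have [m] := ubnP (j - i); elim: m => // m IHm in j ij w *; rewrite ltnS => jim.
have [->|nij] := eqVneq i j; first by rewrite tperm1 mul1g.
have lt_ij : i < j by rewrite ltn_neqAle ij andbT.
have [ij1|nij1] := eqVneq (j : nat) i.+1.
  exact/connect1/quantum_bruhat_adj.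
have j1n : j.-1 < n by apply: leq_ltn_trans (leq_pred _) (ltn_ord j).
pose k := Ordinal j1n.
have jk : j = k.+1 :> nat by rewrite /= prednK //; lia.
have nik : i != k by rewrite -val_eqE /=; lia.
have -> : tperm i j = (tperm k j * (tperm i k * tperm k j))%g.
  rewrite -{1}(tpermV k j) -/(conjg _ _) tpermJ tpermL tpermD //.
    by rewrite eq_sym.
  by rewrite eq_sym.
rewrite -!mulgA.
apply: connect_trans (connect1 (quantum_bruhat_adj _ jk)) _.
apply: connect_trans _ (connect1 (quantum_bruhat_adj _ jk)).
by apply: IHm; rewrite /=; lia.
Qed.

Lemma quantum_bruhat_connected (n : nat) (u v : 'S_n) :
  exists k : nat,
    [exists p : k.-tuple 'S_n, path (@quantum_bruhat n) u p && (last u p == v)].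
Proof.
suff /connectP[p up ->] : connect (@quantum_bruhat n) u v.
  by exists (size p); apply/existsP; exists (in_tuple p); rewrite up eqxx.
have [ts def_vu _] := prod_tpermP (v * u^-1)%g.
rewrite -[v](mulgKV u) def_vu; elim: ts {def_vu} => [|t ts IHts].
  by rewrite big_nil mul1g.
by rewrite big_cons -mulgA; apply: connect_trans IHts (connect_tperm _ _ _).
Qed.

Definition qdist (n : nat) (u v : 'S_n) : nat :=
  ex_minn (quantum_bruhat_connected u v).

Definition tilted_le (n : nat) (u : 'S_n) : rel 'S_n := fun w v =>
  qdist u w + qdist w v == qdist u v.

Definition tilted_interval (n : nat) (u v : 'S_n) : {set 'S_n} :=
  [set x | tilted_le u u x && tilted_le u x v].

(* (x + (n - r)) %% n is the rank of x in r <_r r+1 <_r ... <_r r-1. *)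
Definition shift_le (n : nat) (r : 'I_n) : rel 'I_n := fun x y =>
  (x + (n - r)) %% n <= (y + (n - r)) %% n.

(* all2 is false on sequences of different sizes. *)
Definition gale_le (n : nat) (r : 'I_n) : rel {set 'I_n} := fun A B =>
  all2 (shift_le r) (sort (shift_le r) (enum A)) (sort (shift_le r) (enum B)).

Definition prefix_set (n : nat) (w : 'S_n) (k : nat) : {set 'I_n} :=
  [set w i | i : 'I_n & i < k].

(* Main.v *)
Require Import Defs.
From mathcomp Require Import all_boot all_fingroup.
From mathcomp Require Import zify.

Set Implicit Arguments.
Unset Strict Implicit.
Unset Printing Implicit Defensive.

Local Open Scope nat_scope.

(**
Everything is read off the counts R w k x = #{q < k : w q < x} (prefix_count).
Let m_k(u,v) be the maximum over x of R v k x - R u k x (qexponent); it is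
nonnegative, since x = 0 gives 0.

Cutting the cycle of values at r, the Gale condition {u_1..u_k} <=_r
{v_1..v_k} compares counts over the cyclic intervals starting at r, and it says
exactly that x |-> R v k x - R u k x is maximal at r (gale_leE).  Since
R v - R u = (R v - R w) + (R w - R u), some r satisfies both Gale conditions
through w iff m_k(u,w) + m_k(w,v) = m_k(u,v), and then every r that satisfies
the condition for (u,v) does.  So the existential and the universal condition
on the sequences both say that m_k is additive along u, w, v for each k.

It remains to link this with distances, by the formula (qdistE)
  d(u,v) = l(v) - l(u) + 2 * sum_k m_k(u,v).
As m_k is subadditive, d(u,w) + d(w,v) = d(u,v) iff m_k is additive for every k.

The lower bound on d holds because an edge from u to u' satisfies
l(u') - l(u) + 2 * sum_k m_k(u,u') <= 1, and sum_k m_k is subadditive.  For the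
upper bound, every u != v has an edge to some u' from which the right-hand side
drops by one (exists_step).  Let i be the first position where u and v
differ, and j > i the first position with u_j in the cyclic interval (u_i, v_i];
then u' exchanges positions i and j.  No value between them lies cyclically
between u_i and u_j, which makes this an edge.  For i < k <= j the exchange adds
to R v k - R u k, up to a constant, the indicator of the thresholds x in the
cyclic interval (u_i, u_j], and on all of (u_i, v_i] this difference is below
its value at v_i + 1 (prefix_count_lt), so the place of the maximum survives.
*)

Definition prefix_count (n : nat) (w : 'S_n) (k x : nat) : nat :=
  \sum_(q < n) (q < k) && (w q < x).

(** The minimal exponent of the quantum parameter q_k over all paths from u to
    v in the quantum Bruhat graph. *)
Definition qexponent (n : nat) (u v : 'S_n) (k : nat) : nat :=
  \max_(x < n) (prefix_count v k x - prefix_count u k x).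

Definition qdegree (n : nat) (u v : 'S_n) : nat :=
  \sum_(k < n.-1) qexponent u v k.+1.

(** * Prefix counts *)

Lemma sum_split2 (T : finType) (i j : T) (F : T -> nat) : i != j ->
  \sum_q F q = F i + F j + \sum_(q | (q != i) && (q != j)) F q.
Proof. by move=> ij; rewrite (bigD1 i) // (bigD1 j) 1?eq_sym //= addnA. Qed.

Section PrefixCount.

Variable n : nat.
Implicit Types (u v w : 'S_n) (i j r : 'I_n) (k x : nat).

Lemma prefix_count0 w k : prefix_count w k 0 = 0.
Proof. by apply: big1 => q _; rewrite ltn0 andbF. Qed.

Lemma prefix_count_ge w k x :
  n <= x -> prefix_count w k x = \sum_(q < n) (q < k).
Proof.
by move=> nx; apply: eq_bigr => q _; rewrite (leq_trans (ltn_ord _) nx) andbT.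
Qed.

(** Only the prefixes that contain position i but not position j see the
    exchange. *)
Lemma prefix_count_tperm i j w k x : i < j ->
  prefix_count (tperm i j * w)%g k x + [&& i < k, k <= j & w i < x] =
  prefix_count w k x + [&& i < k, k <= j & w j < x].
Proof.
move=> ij; have nij : j != i by rewrite -val_eqE /=; lia.
rewrite /prefix_count 2!(sum_split2 _ nij) !permM tpermL tpermR.
rewrite (eq_bigr (fun q : 'I_n => (q < k) && (w q < x) : nat)); last first.
  by move=> q /andP[qj qi]; rewrite permM tpermD // eq_sym.
by set S := (\sum_(_ | _) _); lia.
Qed.

Lemma leq_prefix_count u v k x :
  prefix_count v k x <= prefix_count u k x + qexponent u v k.
Proof.
case: (ltnP x n) => [xn | nx]; last by rewrite !prefix_count_ge // leq_addr.
by rewrite -leq_subLR (leq_bigmax (Ordinal xn)).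
Qed.

Lemma leq_qexponent u v k m :
  (forall x, prefix_count v k x <= prefix_count u k x + m) ->
  qexponent u v k <= m.
Proof. by move=> le_m; apply/bigmax_leqP => x _; rewrite leq_subLR. Qed.

(** The truncated subtraction hides where the maximum sits when it is 0; the
    threshold 0 then serves. *)
Lemma qexponent_attained u v k : 0 < n ->
  exists r, prefix_count v k r = prefix_count u k r + qexponent u v k.
Proof.
move=> n_gt0; have [|r def_m] := @eq_bigmax 'I_n
  (fun x : 'I_n => prefix_count v k x - prefix_count u k x);
  first by rewrite card_ord.
have [/eqP q0 | q_gt0] := posnP (qexponent u v k).
  by exists (Ordinal n_gt0); rewrite !prefix_count0 (eqP q0).
by exists r; move: q_gt0; rewrite /qexponent def_m; lia.
Qed.

Lemma qexponent_triangle u w v k :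
  qexponent u v k <= qexponent u w k + qexponent w v k.
Proof.
apply: leq_qexponent => x.
by have := leq_prefix_count u w k x; have := leq_prefix_count w v k x; lia.
Qed.

Lemma qdegree_triangle u w v : qdegree u v <= qdegree u w + qdegree w v.
Proof. by rewrite -big_split leq_sum // => k _; apply: qexponent_triangle. Qed.

Lemma qdegree_refl u : qdegree u u = 0.
Proof.
apply: big1 => k _; apply/eqP; rewrite -leqn0.
by apply: leq_qexponent => x; rewrite leq_addr.
Qed.

Lemma qexponent_tperm i j w k : i < j ->
  qexponent w (tperm i j * w)%g k <= [&& i < k, k <= j & w j < w i].
Proof.
move=> ij; apply: leq_qexponent => x.
by have := prefix_count_tperm w k x ij; lia.
Qed.

End PrefixCount.

(** * Lengths and edges *)

Lemma sum_pair_split2 (T : finType) (i j : T) (F : T -> T -> nat) : i != j ->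
  \sum_p \sum_q F p q =
  F i i + F i j + F j i + F j j
  + \sum_(q | (q != i) && (q != j)) (F i q + F q i + F j q + F q j)
  + \sum_(p | (p != i) && (p != j)) \sum_(q | (q != i) && (q != j)) F p q.
Proof.
move=> ij; rewrite 3!(sum_split2 _ ij).
under [X in _ + _ + X = _]eq_bigr do rewrite (sum_split2 _ ij).
by rewrite !big_split /=; lia.
Qed.

(** The effect on the inversions that involve a third position q, with value c,
    of exchanging the values a and b of positions i and j. *)
Lemma swap_inversions (i j q a b c : nat) :
  i < j -> a < b -> q != i -> q != j -> c != a -> c != b ->
  ((i < q) && (c < b)) + ((q < i) && (b < c))
  + ((j < q) && (c < a)) + ((q < j) && (a < c)) =
  ((i < q) && (c < a)) + ((q < i) && (a < c))
  + ((j < q) && (c < b)) + ((q < j) && (b < c))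
  + 2 * [&& i < q, q < j, a < c & c < b].
Proof. lia. Qed.

(** The half-open cyclic interval (a, b], given by the three ways in which the
    cyclic order a, y, b can be cut into a linear one. *)
Definition cyc_itv (a b y : nat) : bool :=
  [|| a < y <= b, y <= b < a | b < a < y].

Lemma cyc_end a b : a != b -> cyc_itv a b b.
Proof. by rewrite /cyc_itv; case: ltngtP; lia. Qed.

Lemma cyc_sub a b c y : cyc_itv a b c -> cyc_itv a c y -> cyc_itv a b y.
Proof. by rewrite /cyc_itv; case: (ltngtP a b); case: (ltngtP a c); lia. Qed.

(** The next three lemmas compare indicator functions of a single value, as
    summands of prefix counts.  For x in (a, b], the value b belongs to [x, b]
    and a does not. *)
Lemma cyc_count_lt a b x : a != b -> cyc_itv a b x ->
  (b < x) + (a < b.+1) < (a < x) + (b < b.+1).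
Proof.
rewrite /cyc_itv.
by case: (ltngtP a b); case: (leqP x b); case: (leqP x a); lia.
Qed.

(** A value c outside (a, b] is outside [x, b], so an arbitrary value d
    contributes at least as much as c to the count over [x, b]. *)
Lemma cyc_count_le a b x c d : cyc_itv a b x -> ~~ cyc_itv a b c ->
  (d < x) + (c < b.+1) <= (c < x) + (d < b.+1).
Proof.
rewrite /cyc_itv; case: (ltngtP a b); case: (leqP x b); case: (leqP c b);
  by case: (leqP d b); try lia.
Qed.

(** The combination (c < a) + (a < x) - (c < x) is the indicator of x in
    (a, c], whether or not this interval wraps around, and (a, c] is contained
    in (a, b]. *)
Lemma cyc_count_out a b c x : cyc_itv a b c -> ~~ cyc_itv a b x ->
  (c < a) + (a < x) <= (c < x).
Proof.
rewrite /cyc_itv; case: (ltngtP a b); case: (leqP x b); case: (leqP c b);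
  by case: (leqP x a); case: (leqP c a); try lia.
Qed.

Section Edges.

Variable n : nat.
Implicit Types (u v w : 'S_n) (i j : 'I_n).

Lemma perm_lengthE w :
  perm_length w = \sum_(p < n) \sum_(q < n) ((p < q) && (w q < w p)).
Proof.
rewrite /perm_length cardsE -sum1_card big_mkcond pair_bigA /=.
by apply: eq_bigr => -[p q] _; rewrite unfold_in /=; case: ifP.
Qed.

Lemma perm_length_tperm i j w : i < j -> w i < w j ->
  perm_length (tperm i j * w)%g =
  perm_length w + 1 + 2 * \sum_(q < n) [&& i < q, q < j, w i < w q & w q < w j].
Proof.
move=> ij wij; have nij : i != j by rewrite -val_eqE /=; lia.
rewrite [X in 2 * X](sum_split2 _ nij) !perm_lengthE !(sum_pair_split2 _ nij).
rewrite !permM tpermL tpermR.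
have -> : \sum_(p < n | (p != i) && (p != j))
            \sum_(q < n | (q != i) && (q != j))
              ((p < q) && ((tperm i j * w)%g q < (tperm i j * w)%g p)) =
          \sum_(p < n | (p != i) && (p != j))
            \sum_(q < n | (q != i) && (q != j)) ((p < q) && (w q < w p)).
  apply: eq_bigr => p /andP[pi pj]; apply: eq_bigr => q /andP[qi qj].
  by rewrite !permM !tpermD // eq_sym.
set X := \sum_(p < n | _) \sum_(q < n | _) _.
have -> : \sum_(q < n | (q != i) && (q != j))
    ((i < q) && ((tperm i j * w)%g q < w j)
     + (q < i) && (w j < (tperm i j * w)%g q)
     + (j < q) && ((tperm i j * w)%g q < w i)
     + (q < j) && (w i < (tperm i j * w)%g q)) =
  \sum_(q < n | (q != i) && (q != j))
    ((i < q) && (w q < w i) + (q < i) && (w i < w q)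
     + (j < q) && (w q < w j) + (q < j) && (w j < w q)
     + 2 * [&& i < q, q < j, w i < w q & w q < w j]).
  apply: eq_bigr => q /andP[qi qj].
  rewrite permM tpermD; try by rewrite eq_sym.
  by apply: swap_inversions; rewrite // val_eqE (inj_eq perm_inj).
rewrite big_split /= -big_distrr /=.
set Y := \sum_(q < n | _) _; set Z := \sum_(q < n | _) _.
by lia.
Qed.

Lemma sum_nat_interval N a b :
  \sum_(k < N) (a <= k < b) = minn b N - minn a N.
Proof.
elim: N => [|N IHN]; first by rewrite big_ord0; lia.
by rewrite big_ord_recr /= IHN; lia.
Qed.

Lemma qdegree_tperm i j w : i < j ->
  qdegree w (tperm i j * w)%g <= (w j < w i) * (j - i).
Proof.
move=> ij; apply: (@leq_trans ((w j < w i) * \sum_(k < n.-1) (i <= k < j))).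
  rewrite big_distrr leq_sum // => k _.
  by apply: leq_trans (qexponent_tperm w _ ij) _; rewrite /= mulnb; lia.
rewrite sum_nat_interval leq_mul2l; apply/orP; right.
by have := ltn_ord j; lia.
Qed.

(** The sign of w_j - w_i determines the sign of the change of length, hence
    which of the two kinds of edges this is. *)
Lemma perm_length_edge u v : quantum_bruhat u v ->
  perm_length v + 2 * qdegree u v <= perm_length u + 1.
Proof.
case/existsP=> i /existsP[j /and3P[ij /eqP-> len_eq]].
have deg_le := qdegree_tperm u ij.
have [uij|uji|/val_inj/perm_inj eq_ij] := ltngtP (u i) (u j).
- have := perm_length_tperm ij uij; set S := \sum_(_ < _) _ => len_up.
  by move: deg_le len_eq; rewrite (leq_gtF (ltnW uij)) mul0n; lia.
- have := @perm_length_tperm i j (tperm i j * u)%g ij.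
  rewrite !permM tpermL tpermR mulgA tperm2 mul1g => /(_ uji).
  by move: deg_le; rewrite uji mul1n; lia.
- by move: ij; rewrite eq_ij ltnn.
Qed.

(** Both kinds of edges obey one cyclically invariant criterion: an up-step
    needs no intermediate value in ]w_i, w_j[, and a down-step needs all of
    them in ]w_j, w_i[, which is the largest possible drop of the length. *)
Lemma quantum_bruhat_tperm i j w : i < j ->
  (forall q : 'I_n, i < q < j -> ~~ cyc_itv (w i) (w j) (w q)) ->
  quantum_bruhat w (tperm i j * w)%g /\
  perm_length (tperm i j * w)%g + 2 * ((w j < w i) * (j - i)) =
    perm_length w + 1.
Proof.
move=> ij gap.
have len_eq : perm_length (tperm i j * w)%g + 2 * ((w j < w i) * (j - i)) =
    perm_length w + 1.
  have [wij|wji|/val_inj/perm_inj eq_ij] := ltngtP (w i) (w j).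
  - rewrite (perm_length_tperm ij wij) big1 => [|q _]; first by lia.
    apply/eqP; rewrite eqb0; apply/negP => /and4P[iq qj wiq wqj].
    by have := gap q; rewrite iq qj => /(_ isT); rewrite /cyc_itv wiq ltnW.
  - have := @perm_length_tperm i j (tperm i j * w)%g ij.
    rewrite !permM tpermL tpermR mulgA tperm2 mul1g => /(_ wji) ->.
    rewrite (eq_bigr (fun q : 'I_n => i.+1 <= q < j : nat)) => [|q _].
      by rewrite sum_nat_interval; have := ltn_ord j; lia.
    congr nat_of_bool; have [iqj|niqj] := boolP (i < q < j); last by lia.
    have [qi qj] : q != i /\ q != j by rewrite -!val_eqE /=; lia.
    rewrite permM tpermD; try by rewrite eq_sym.
    have wqi : w q <> w i :> nat.
      by move/val_inj/perm_inj/eqP; rewrite (negPf qi).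
    by have := gap q iqj; rewrite /cyc_itv; lia.
  - by move: ij; rewrite eq_ij ltnn.
split=> //; apply/existsP; exists i; apply/existsP; exists j.
rewrite ij eqxx /=; move: len_eq.
by case: (w j < w i); lia.
Qed.

End Edges.

Section Step.

Variable n : nat.
Variables (u v : 'S_n) (i j : 'I_n).

Hypothesis (uv_i : u i != v i) (uv_lt : forall q : 'I_n, q < i -> u q = v q).
Hypothesis (ij : i < j) (uj_in : cyc_itv (u i) (v i) (u j)).
Hypothesis gap : forall q : 'I_n, i < q < j -> ~~ cyc_itv (u i) (v i) (u q).

(** Up to position i the prefixes of u and v contribute alike to the values
    cyclically in [x, v_i]; at position i only v contributes, and between i and
    j nothing of u does. *)
Lemma prefix_count_lt k x : i < k <= j -> cyc_itv (u i) (v i) x ->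
  prefix_count v k x + prefix_count u k (v i).+1 <
  prefix_count u k x + prefix_count v k (v i).+1.
Proof.
move=> ikj x_in; rewrite /prefix_count -!big_split /=.
rewrite (bigD1 i) // [X in _ < X](bigD1 i) //= -addSn.
apply: leq_add.
  by have /andP[-> _] := ikj; apply: cyc_count_lt.
apply: leq_sum => q; rewrite -val_eqE /= => qi.
have [lt_qi|le_iq] := ltnP q i; first by rewrite uv_lt // addnC.
have [lt_qk|//] := ltnP q k; apply: cyc_count_le x_in (gap _).
by lia.
Qed.

(** The exchange changes v - u counts by the indicator of (u_i, u_j], minus 1
    if that interval wraps around.  Where the indicator is 1, the count
    at v_i + 1 leaves room for it. *)
Lemma qexponent_step k :
  qexponent (tperm i j * u)%g v k + [&& i < k, k <= j & u j < u i]
    <= qexponent u v k.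
Proof.
have key x : prefix_count v k x + [&& i < k, k <= j & u j < u i] <=
    prefix_count (tperm i j * u)%g k x + qexponent u v k.
  have := prefix_count_tperm u k x ij; have := leq_prefix_count u v k x.
  have [/= ikj|nikj] := boolP (i < k <= j); last first.
    by move: nikj; case: (i < k); case: (k <= j) => //= _; lia.
  have /andP[-> ->] := ikj => /=.
  have [x_in|x_out] := boolP (cyc_itv (u i) (v i) x).
    have := prefix_count_lt ikj x_in; have := leq_prefix_count u v k (v i).+1.
    by set a := nat_of_ord (u i); set b := nat_of_ord (u j); lia.
  have := cyc_count_out uj_in x_out.
  by set a := nat_of_ord (u i); set b := nat_of_ord (u j); lia.
(* The threshold 0 gives the room that the truncated subtraction below needs. *)
have := key 0; rewrite !prefix_count0 !add0n => c_le.
rewrite addnC -leq_subRL //; apply: leq_qexponent => x.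
by have := key x; lia.
Qed.

End Step.

(** * Distances *)

Section Distance.

Variable n : nat.
Implicit Types (u v w : 'S_n).

Lemma perm_length_path u p : path (@quantum_bruhat n) u p ->
  perm_length (last u p) + 2 * qdegree u (last u p) <= size p + perm_length u.
Proof.
elim: p u => [|w p IHp] u /=.
  by rewrite qdegree_refl addn0.
case/andP=> /perm_length_edge uw /IHp.
by have := qdegree_triangle u w (last w p); lia.
Qed.

Lemma exists_step u v : u != v -> exists w,
  quantum_bruhat u w /\
  perm_length u + 1 + 2 * qdegree w v <= perm_length w + 2 * qdegree u v.
Proof.
move=> uv.
have [i uv_i uv_lt] : exists2 i : 'I_n,
    u i != v i & forall q : 'I_n, q < i -> u q = v q.
  have /existsP[i0 i0P] : [exists i, u i != v i].
    apply: contraNT uv; rewrite negb_exists => /forallP uv.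
    by apply/eqP/permP => i; apply/eqP; have := uv i; rewrite negbK.
  have [i uv_i i_min] := @arg_minnP _ i0 (fun i => u i != v i) val i0P.
  exists i => // q qi; apply/eqP; apply: contraTT qi => /i_min.
  by rewrite -leqNgt.
have [j [ij uj_in gap]] : exists j : 'I_n, [/\ i < j,
    cyc_itv (u i) (v i) (u j) &
    forall q : 'I_n, i < q < j -> ~~ cyc_itv (u i) (v i) (u q)].
  (* The position of v_i in u qualifies, so a least such j exists. *)
  pose P (j : 'I_n) := (i < j) && cyc_itv (u i) (v i) (u j).
  have Pj0 : P (u^-1%g (v i)).
    rewrite /P permKV cyc_end // andbT ltn_neqAle leqNgt; apply/andP; split.
      by apply: contraNneq uv_i => /val_inj ei; rewrite -[v i](permKV u) -ei.
    apply/negP => lt_i.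
    have /perm_inj eq_i := etrans (esym (uv_lt _ lt_i)) (permKV u (v i)).
    by rewrite eq_i ltnn in lt_i.
  have [j /andP[ij uj_in] j_min] := @arg_minnP _ _ P val Pj0.
  exists j; split=> // q /andP[iq qj]; apply: contraTN qj => cq.
  by rewrite -leqNgt j_min // /P iq.
exists (tperm i j * u)%g.
have [|uw len_w] := @quantum_bruhat_tperm n i j u ij.
  by move=> q /gap; apply/contraNN/cyc_sub.
split=> //.
suff : qdegree (tperm i j * u)%g v + (u j < u i) * (j - i) <= qdegree u v.
  by move: len_w; set d := _ * (j - i); lia.
have -> : (u j < u i) * (j - i) = \sum_(k < n.-1) (i <= k < j) && (u j < u i).
  under eq_bigr do rewrite -mulnb; rewrite -big_distrl sum_nat_interval mulnC.
  by congr (_ * _); have := ltn_ord j; lia.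
rewrite -big_split leq_sum // => k _.
by rewrite -andbA; apply: qexponent_step.
Qed.

(** Iterating the step terminates because the length bound on the path strictly
    decreases; the summand n * n keeps the measure nonnegative, as lengths are
    at most n * n. *)
Lemma exists_path u v : exists p,
  [/\ path (@quantum_bruhat n) u p, last u p = v &
      size p + perm_length u <= perm_length v + 2 * qdegree u v].
Proof.
have len_max w : perm_length w <= n * n.
  by rewrite /perm_length (leq_trans (max_card _)) // card_prod card_ord.
have [m] := ubnP (n * n + perm_length v + 2 * qdegree u v - perm_length u).
elim: m u => // m IHm u; rewrite ltnS => le_m.
have [-> | /exists_step[w [uw len_w]]] := eqVneq u v.
  by exists [::]; split=> //=; lia.
have [|p [wp pv len_p]] := IHm w.
  by have := len_max u; have := len_max w; lia.
exists (w :: p); split=> //=; first by rewrite uw.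
by lia.
Qed.

Lemma qdistE u v : qdist u v + perm_length u = perm_length v + 2 * qdegree u v.
Proof.
rewrite /qdist; case: ex_minnP => d /existsP[p /andP[up /eqP pv]] d_min.
apply/eqP; rewrite eqn_leq; apply/andP; split; last first.
  by have := perm_length_path up; rewrite pv size_tuple.
have [q [uq qv len_q]] := exists_path u v.
apply: leq_trans len_q; rewrite leq_add2r d_min //.
by apply/existsP; exists (in_tuple q); rewrite uq qv eqxx.
Qed.

(** Equality in a sum of triangle inequalities forces equality in each. *)
Lemma tilted_leE u w v :
  tilted_le u w v = [forall k : 'I_n.-1,
    qexponent u w k.+1 + qexponent w v k.+1 == qexponent u v k.+1].
Proof.
have -> : tilted_le u w v = (qdegree u v == qdegree u w + qdegree w v).
  rewrite /tilted_le.
  have := qdistE u w; have := qdistE w v; have := qdistE u v.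
  by move=> *; apply/eqP/eqP; lia.
rewrite -big_split /=.
have := @leqif_sum 'I_n.-1 predT
  (fun k => qexponent u v k.+1 == qexponent u w k.+1 + qexponent w v k.+1)
  (fun k => qexponent u v k.+1)
  (fun k => qexponent u w k.+1 + qexponent w v k.+1).
case=> [k _|_ ->]; first by split=> //; apply: qexponent_triangle.
by apply: eq_forallb => k; rewrite eq_sym.
Qed.

End Distance.

(** * The shifted Gale order *)

Lemma all2_map (T T' : Type) (f : T' -> T) (r : rel T) (s t : seq T') :
  all2 r (map f s) (map f t) = all2 (relpre f r) s t.
Proof. by elim: s t => [|x s IHs] [|y t] //=; rewrite IHs. Qed.

(** Entrywise comparison of sorted sequences is a comparison of their counting
    functions, which no longer mentions the sorting. *)
Lemma all2_leq_sorted (s t : seq nat) :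
  sorted leq s -> sorted leq t -> size s = size t ->
  all2 leq s t <->
  forall y, count (fun z => z < y) t <= count (fun z => z < y) s.
Proof.
elim: s t => [|a s IHs] [|b t] //= s_sorted t_sorted [st].
have {}IHs := IHs t (path_sorted s_sorted) (path_sorted t_sorted) st.
split=> [/andP[ab /IHs le_ts] y | le_ts].
  by have := le_ts y; lia.
have ab : a <= b.
  rewrite leqNgt; apply/negP => ba; have := le_ts b.+1.
  suff -> : count (fun z => z < b.+1) s = 0 by lia.
  apply/eqP; rewrite -leqn0 leqNgt -has_count; apply/hasPn => z sz.
  by have := allP (order_path_min leq_trans s_sorted) z sz; lia.
rewrite ab; apply/IHs => y; have := le_ts y.
have [lt_by | le_yb] := ltnP b y; first by lia.
suff -> : count (fun z => z < y) t = 0 by lia.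
apply/eqP; rewrite -leqn0 leqNgt -has_count; apply/hasPn => z tz.
by have := allP (order_path_min leq_trans t_sorted) z tz; lia.
Qed.

Section Gale.

Variable n : nat.
Implicit Types (u v w : 'S_n) (r : 'I_n).

Definition shift_rank r (x : 'I_n) : nat := (x + (n - r)) %% n.

Definition shifted_count r w k y : nat :=
  \sum_(q < n) (q < k) && (shift_rank r (w q) < y).

(** In the order cut at r, the elements of rank below y form the interval
    [r, r + y[, which wraps around 0 when r + y exceeds n. *)
Lemma shift_rank_lt r (z : 'I_n) y : y <= n ->
  (shift_rank r z < y) + (z < r) =
  if r + y <= n then (z < r + y) : nat else 1 + (z < r + y - n).
Proof.
move=> yn; rewrite /shift_rank.
have rn := ltn_ord r; have zn := ltn_ord z.
have -> : (z + (n - r)) %% n = if r <= z then z - r else z + n - r.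
  case: leqP => h; last by rewrite modn_small; lia.
  have -> : z + (n - r) = (z - r) + n by lia.
  by rewrite modnDr modn_small; lia.
by case: ifP; case: ifP; lia.
Qed.

Lemma shifted_countE r w k y : y <= n ->
  shifted_count r w k y + prefix_count w k r =
  if r + y <= n then prefix_count w k (r + y)
  else prefix_count w k n + prefix_count w k (r + y - n).
Proof.
move=> yn; rewrite -big_split (prefix_count_ge _ _ (leqnn n)) /=.
have rank_lt q := shift_rank_lt r (w q) yn.
case: ifP rank_lt => _ rank_lt; last rewrite -big_split;
  by apply: eq_bigr => q _ /=; have := rank_lt q; case: (q < k); lia.
Qed.

Lemma count_prefix_set w k (P : pred 'I_n) :
  count P (enum (prefix_set w k)) = \sum_(q < n) (q < k) && P (w q).
Proof.
rewrite -sum1_count big_enum_cond big_imset_cond => [|? ? _ _ /perm_inj //].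
rewrite big_mkcond; apply: eq_bigr => q _.
by rewrite inE; case: ifP.
Qed.

Lemma gale_leP r u v k :
  gale_le r (prefix_set u k) (prefix_set v k) <->
  forall y, shifted_count r v k y <= shifted_count r u k y.
Proof.
have sizeE w : size (enum (prefix_set w k)) = \sum_(q < n) (q < k).
  rewrite -count_predT count_prefix_set.
  by apply: eq_bigr => q _; rewrite andbT.
have -> : gale_le r (prefix_set u k) (prefix_set v k) =
    all2 leq (sort leq (map (shift_rank r) (enum (prefix_set u k))))
             (sort leq (map (shift_rank r) (enum (prefix_set v k)))).
  by rewrite !sort_map all2_map.
rewrite all2_leq_sorted ?(sort_sorted leq_total) //; last first.
  by rewrite !size_sort !size_map !sizeE.
by split=> le_vu y; have := le_vu y;
  rewrite !count_sort !count_map !count_prefix_set.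
Qed.

(** The initial segments of the order cut at r are the cyclic intervals from r
    to x, and their counts are R x - R r, or R n + R x - R r when they wrap
    around.  As R n is the same for u and v, comparing these counts for all x
    says that R v - R u is largest at r. *)
Lemma gale_leE r u v k :
  gale_le r (prefix_set u k) (prefix_set v k) =
  (prefix_count v k r == prefix_count u k r + qexponent u v k).
Proof.
have rn := ltn_ord r.
have full : prefix_count u k n = prefix_count v k n by rewrite !prefix_count_ge.
apply/idP/eqP => [/gale_leP le_vu | max_r].
  apply/eqP; rewrite eqn_leq leq_prefix_count /=.
  suff le_m : qexponent u v k <= prefix_count v k r - prefix_count u k r.
    have := le_vu (n - r); have := shifted_countE r u k (leq_subr r n).
    have := shifted_countE r v k (leq_subr r n).
    by rewrite subnKC ?(ltnW rn) // ?leqnn; lia.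
  apply: leq_qexponent => x.
  have [-> | x_gt0] := posnP x; first by rewrite !prefix_count0.
  have [xr | rx] := leqP x r.
    have yn : x + n - r <= n by lia.
    have := le_vu (x + n - r).
    have := shifted_countE r u k yn; have := shifted_countE r v k yn.
    have -> : r + (x + n - r) = n + x by lia.
    by rewrite addKn leqNgt -[X in X < _]addn0 ltn_add2l x_gt0 /=; lia.
  have [nx | xn] := leqP n x.
    by rewrite (prefix_count_ge v k nx) (prefix_count_ge u k nx) leq_addr.
  have yn : x - r <= n by lia.
  have := le_vu (x - r).
  have := shifted_countE r u k yn; have := shifted_countE r v k yn.
  by rewrite subnKC ?(ltnW rx) // (ltnW xn); lia.
apply/gale_leP => y; have [yn | ny] := leqP y n.
  have := shifted_countE r u k yn; have := shifted_countE r v k yn.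
  have := leq_prefix_count u v k (r + y).
  have := leq_prefix_count u v k (r + y - n).
  by case: ifP; lia.
apply: leq_sum => q _; case: (q < k) => //=.
rewrite (leq_trans (leq_b1 _)) // lt0b.
by apply: ltn_trans ny; apply: ltn_pmod; lia.
Qed.

End Gale.

(* The index k : 'I_n.-1 stands for the prefix length k.+1 in {1, ..., n-1}. *)
Theorem theorem3p9 (n : nat) (u v w : 'S_n) :
  [<-> tilted_le u w v;
       w \in tilted_interval u v;
       forall a : (n.-1).-tuple 'I_n,
         (forall k : 'I_n.-1,
            gale_le (tnth a k) (prefix_set u k.+1) (prefix_set v k.+1)) ->
         forall k : 'I_n.-1,
           gale_le (tnth a k) (prefix_set u k.+1) (prefix_set w k.+1) /\
           gale_le (tnth a k) (prefix_set w k.+1) (prefix_set v k.+1);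
       exists a : (n.-1).-tuple 'I_n,
         forall k : 'I_n.-1,
           gale_le (tnth a k) (prefix_set u k.+1) (prefix_set w k.+1) /\
           gale_le (tnth a k) (prefix_set w k.+1) (prefix_set v k.+1)].
Proof.
tfae.
- move=> uwv; rewrite inE uwv andbT /tilted_le.
  by have := qdistE u u; rewrite qdegree_refl; lia.
- rewrite inE => /andP[_]; rewrite tilted_leE => /forallP add_k a uv_a k.
  have /eqP := add_k k; move: (uv_a k); rewrite !gale_leE => /eqP.
  have := leq_prefix_count u w k.+1 (tnth a k).
  have := leq_prefix_count w v k.+1 (tnth a k).
  by move=> *; split; apply/eqP; lia.
- move=> uwv.
  have /fin_all_exists[f fP] (k : 'I_n.-1) : exists r : 'I_n,
      gale_le r (prefix_set u k.+1) (prefix_set v k.+1).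
    have [|r def_r] := @qexponent_attained n u v k.+1.
      by have := ltn_ord k; lia.
    by exists r; rewrite gale_leE; apply/eqP.
  exists [tuple f k | k < n.-1]; apply: uwv => k.
  by rewrite tnth_mktuple.
- case=> a uwv; rewrite tilted_leE; apply/forallP => k.
  have [] := uwv k; rewrite !gale_leE => /eqP uw /eqP wv.
  have := leq_prefix_count u v k.+1 (tnth a k).
  by have := qexponent_triangle u w v k.+1; move=> *; apply/eqP; lia.
Qed.
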